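(* Let $\mathbf M^*\in\mathbb R^{d_1\times d_2}$ have rank $r$, let $\sigma_r=\sigma_r(\mathbf M^* )$ be its smallest nonzero singular value, and let $f:\mathbb R^{d_1\times d_2}\to\mathbb R_+$ be of the form $f(\mathbf M)=\sum_{i=1}^n\rho(\langle \mathbf M,\mathbf X_i\rangle-Y_i)$ with $\rho:\mathbb R\to\mathbb R_+$. Let $\tau_{\rm comp}>\tau_{\rm stat}>0$ and $\mu_{\rm comp},\mu_{\rm stat},L_{\rm comp},L_{\rm stat}>0$, and suppose $f$ satisfies the dual-phase regularity conditions (see context) with respect to $\mathbf M^*$ with these parameters. Suppose the initialization $\mathbf M_0\in\mathbb M_r$ satisfies $$\|\mathbf M_0-\mathbf M^*\|_{\rm F}\le c_0\sigma_r\cdot\min\{\mu_{\rm stat}^2L_{\rm stat}^{-2},\ \mu_{\rm comp}^2L_{\rm comp}^{-2}\}$$ for a small but absolute constant $c_0>0$, and the initial stepsize satisfies $\eta_0\in\big[0.2\|\mathbf M_0-\mathbf M^*\|_{\rm F}\,\mu_{\rm comp}L_{\rm comp}^{-2},\ 0.3\|\mathbf M_0-\mathbf M^*\|_{\rm F}\,\mu_{\rm comp}L_{\rm comp}^{-2}\big]$. At the $l$-th iteration of RsGrad (see context): (1) When $\|\mathbf M_l-\mathbf M^*\|_{\rm F}\ge\tau_{\rm comp}$, namely in phase one, take the stepsize $\eta_l=(1-0.04\,\mu_{\rm comp}^2L_{\rm comp}^{-2})^l\eta_0$; then $$\|\mathbf M_l-\mathbf M^*\|_{\rm F}\le(1-0.04\,\mu_{\rm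 comp}^2L_{\rm comp}^{-2})^l\,\|\mathbf M_0-\mathbf M^*\|_{\rm F}.$$ (2) When $\tau_{\rm comp}>\|\mathbf M_l-\mathbf M^*\|_{\rm F}\ge\tau_{\rm stat}$, namely in phase two, take the stepsize $\eta_l\in[0.125\,\mu_{\rm stat}L_{\rm stat}^{-2},\ 0.75\,\mu_{\rm stat}L_{\rm stat}^{-2}]$; then $$\|\mathbf M_{l+1}-\mathbf M^*\|_{\rm F}\le\Big(1-\frac{\mu_{\rm stat}^2}{32L_{\rm stat}^2}\Big)\|\mathbf M_l-\mathbf M^*\|_{\rm F}.$$
   Context: $\langle \mathbf A,\mathbf B\rangle={\rm tr}(\mathbf A^\top\mathbf B)$; $\|\cdot\|_{\rm F}$ is the Frobenius norm; $\mathbb M_r=\{\mathbf M\in\mathbb R^{d_1\times d_2}:{\rm rank}(\mathbf M)\le r\}$; ${\rm SVD}_r(\cdot)$ is the best rank-$r$ approximation by truncated SVD; $\|\mathbf G\|_{{\rm F},r}=\|{\rm SVD}_r(\mathbf G)\|_{\rm F}$. The data $(\mathbf X_i,Y_i)_{i=1}^n$ are fixed (the statement is deterministic). The sub-differential $\partial f(\mathbf M)$ is the set of sub-gradients, i.e. all $\mathbf G$ with $f(\mathbf N)\ge f(\mathbf M)+\langle\mathbf G,\mathbf N-\mathbf M\rangle$ for all $\mathbf N$. Dual-phase regularity conditions. Let $\mathbb B_1=\{\mathbf M\in\mathbb M_r:\|\mathbf M-\mathbf M^*\|_{\rm F}\ge\tau_{\rm comp}\}$ and $\mathbb B_2=\{\mathbf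 M\in\mathbb M_r:\tau_{\rm comp}>\|\mathbf M-\mathbf M^*\|_{\rm F}\ge\tau_{\rm stat}\}$. (a) Sharpness: $f(\mathbf M)-f(\mathbf M^* )\ge\mu_{\rm comp}\|\mathbf M-\mathbf M^*\|_{\rm F}$ for $\mathbf M\in\mathbb B_1$, and $f(\mathbf M)-f(\mathbf M^* )\ge\mu_{\rm stat}\|\mathbf M-\mathbf M^*\|_{\rm F}^2$ for $\mathbf M\in\mathbb B_2$. (b) Sub-gradient bound: for every $\mathbf G\in\partial f(\mathbf M)$, $\|\mathbf G\|_{{\rm F},r}\le L_{\rm comp}$ if $\mathbf M\in\mathbb B_1$, and $\|\mathbf G\|_{{\rm F},r}\le L_{\rm stat}\|\mathbf M-\mathbf M^*\|_{\rm F}$ if $\mathbf M\in\mathbb B_2$. RsGrad (Riemannian sub-gradient descent): starting from $\mathbf M_0\in\mathbb M_r$, for $l=0,1,\dots$ choose any $\mathbf G_l\in\partial f(\mathbf M_l)$ and set $\mathbf M_{l+1}={\rm SVD}_r\big(\mathbf M_l-\eta_l\mathcal P_{\mathbb T_l}(\mathbf G_l)\big)$, where, for the thin SVD $\mathbf M_l=\mathbf U_l\boldsymbol\Sigma_l\mathbf V_l^\top$, $\mathcal P_{\mathbb T_l}(\mathbf G)=\mathbf U_l\mathbf U_l^\top\mathbf G+\mathbf G\mathbf V_l\mathbf V_l^\top-\mathbf U_l\mathbf U_l^\top\mathbf G\mathbf V_l\mathbf V_l^\top$ is the projection onto the tangent space of $\mathbb M_r$ at $\mathbf M_l$.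
   Formalization: Claims (1) and (2) at iteration l are stated for runs whose earlier iterates all have distance to M* at least tau_stat; once below tau_stat no stepsize is prescribed, and an arbitrary step can break the bounds. *)

(* Defs.v *)
From HB Require Import structures.
From mathcomp Require Import all_boot all_order all_algebra.
From mathcomp Require Import all_classical all_reals.

Set Implicit Arguments.
Unset Strict Implicit.
Unset Printing Implicit Defensive.

Import Order.TTheory GRing.Theory Num.Theory.

Local Open Scope classical_set_scope.
Local Open Scope ring_scope.

Section Defs.
Context {R : realType}.

Section Matrices.
Context {d1 d2 : nat}.
Implicit Types (A B G M : 'M[R]_(d1, d2)).

Definition inner A B : R := \tr (A^T *m B).

Definition frob A : R := Num.sqrt (inner A A).

(* A = U diag(s) V^T with k singular values listed in nonincreasing order.
   With k = minn d1 d2 every A has such a decomposition; with k = r it is the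
   thin SVD of a matrix of rank at most r (zero singular values are allowed). *)
Definition is_svd k A (U : 'M[R]_(d1, k)) (s : k.-tuple R)
    (V : 'M[R]_(d2, k)) : Prop :=
  [/\ U^T *m U = 1%:M, V^T *m V = 1%:M,
      sorted (fun x y : R => y <= x) s, all (fun x : R => 0 <= x) s &
      A = U *m diag_mx (\row_i tnth s i) *m V^T].

(* The tuple is uniquely determined by A; the default is never used. *)
Definition singular_values A : (minn d1 d2).-tuple R :=
  xget [tuple 0 | _ < minn d1 d2]
    [set s | exists U V, is_svd A U s V].

(* sigma r A is the r-th largest singular value, for 1 <= r <= minn d1 d2;
   when \rank A = r it is the smallest nonzero one. *)
Definition sigma (r : nat) A : R := nth 0 (singular_values A) r.-1.

(* A relation: the truncation depends on the SVD chosen when the r-th and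
   (r+1)-st singular values of A coincide. *)
Definition is_svd_trunc (r : nat) A B : Prop :=
  exists (U : 'M[R]_(d1, minn d1 d2)) s V, is_svd A U s V /\
    B = U *m diag_mx (\row_i if (i < r)%N then tnth s i else 0) *m V^T.

Definition svd_trunc (r : nat) A : 'M[R]_(d1, d2) :=
  xget 0 [set B | is_svd_trunc r A B].

(* Independent of the truncation chosen. *)
Definition frob_trunc (r : nat) A : R := frob (svd_trunc r A).

Definition subdiff (f : 'M[R]_(d1, d2) -> R) M : set 'M[R]_(d1, d2) :=
  [set G | forall N, f M + inner G (N - M) <= f N].

Definition tangent_proj k (U : 'M[R]_(d1, k)) (V : 'M[R]_(d2, k)) G :=
  U *m U^T *m G + G *m V *m V^T - U *m U^T *m G *m V *m V^T.

Definition loss n (rho : R -> R) (X : 'I_n -> 'M[R]_(d1, d2)) (Y : 'I_n -> R)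
    M : R :=
  \sum_(i < n) rho (inner M (X i) - Y i).

Definition low_rank (r : nat) : set 'M[R]_(d1, d2) :=
  [set M | (\rank M <= r)%N].

Definition region1 (r : nat) Mstar (tau_comp : R) : set 'M[R]_(d1, d2) :=
  [set M | low_rank r M /\ tau_comp <= frob (M - Mstar)].

Definition region2 (r : nat) Mstar (tau_comp tau_stat : R) :
    set 'M[R]_(d1, d2) :=
  [set M | low_rank r M /\ tau_stat <= frob (M - Mstar) < tau_comp].

Record dual_phase_regular (f : 'M[R]_(d1, d2) -> R) (r : nat) Mstar
    (tau_comp tau_stat mu_comp mu_stat L_comp L_stat : R) : Prop := {
  sharp_comp : forall M, region1 r Mstar tau_comp M ->
    mu_comp * frob (M - Mstar) <= f M - f Mstar;
  sharp_stat : forall M, region2 r Mstar tau_comp tau_stat M ->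
    mu_stat * frob (M - Mstar) ^+ 2 <= f M - f Mstar;
  subgrad_comp : forall M G, region1 r Mstar tau_comp M ->
    subdiff f M G -> frob_trunc r G <= L_comp;
  subgrad_stat : forall M G, region2 r Mstar tau_comp tau_stat M ->
    subdiff f M G -> frob_trunc r G <= L_stat * frob (M - Mstar)
}.

(* One iteration M -> M' with sub-gradient G and stepsize eta; any thin SVD of
   M and any truncated SVD of the updated matrix may be used. *)
Definition rsgrad_step (f : 'M[R]_(d1, d2) -> R) (r : nat) (eta : R) M G M' :
    Prop :=
  subdiff f M G /\
  exists (U : 'M[R]_(d1, r)) s V, is_svd M U s V /\
    is_svd_trunc r (M - eta *: tangent_proj U V G) M'.

End Matrices.
End Defs.

(* Main.v *)
Require Import Defs.
From HB Require Import structures.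
From mathcomp Require Import all_boot all_order all_algebra.
From mathcomp Require Import all_classical all_reals.
From mathcomp Require Import perm complex ring lra.

Set Implicit Arguments.
Unset Strict Implicit.
Unset Printing Implicit Defensive.

Import Order.TTheory GRing.Theory Num.Theory.

Local Open Scope ring_scope.

(** Write [d] for the Frobenius distance from [M] to [Mstar], [P] and [Q] for the
    projections onto the spans of the left and right vectors of its thin SVD, and
    [T X = P X + X Q - P X Q] for the tangent projection.  One iteration first
    forms [N = M - eta T G] and then truncates [N] to rank [r].

    Descent before truncation.  Expanding the square,
    [|N - Mstar|^2 = d^2 - 2 eta <T G, M - Mstar> + eta^2 |T G|^2].  The inner
    product is [<G, M - Mstar>], which sharpness bounds from below because [G] is
    a sub-gradient, up to [<G, E>] with [E = (1 - P) Mstar (1 - Q)].  Two facts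
    control the remaining terms.  A matrix of rank at most [r] pairs with [G] as
    with the truncation of [G], [<G, A> <= |G|_(F,r) |A|] ([inner_le_trunc]),
    whence also [|T G|^2 <= 2 |G|_(F,r)^2].  And the normal part of [Mstar] is of
    second order, [sigma_r |E| <= d^2] ([complement_bound]), since [E] factors
    through the two matrices [(1 - P) (Mstar - M)] and [(Mstar - M) (1 - Q)] and
    the pseudo-inverse of [Mstar].

    Truncation.  The rank-[r] truncation [M'] of [N] is a best approximation, so
    that [|M' - Mstar| <= 2 |N - Mstar|], while [M' - Mstar] is the orthogonal sum
    of a tangential projection of [N - Mstar] and of the normal part of [Mstar] at
    [M'].  By [complement_bound] again, truncation costs only a second-order term
    ([trunc_perturbation]).

    Conclusion.  With [k = mu^2 / L^2], which is at most 2 by [inner_diff_le], an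
    initialization within [sigma_r k / 100] makes every second-order term small
    against the decrease of the squared distance, which is of order [k d^2], and
    scalar inequalities give both rates.  In phase one
    the step size is tuned to the bound [E_l = rate^l d_0] and not to [d_l], which
    may be much smaller; the estimate is convex in [d_l], so it suffices to check
    the two ends of [0 <= d_l <= E_l].  The distance never increases in phase two,
    so an iterate in phase one only has predecessors in phase one.

    All this rests on the existence of singular value decompositions, which is
    proved by deflation: a singular pair of [A], obtained from an eigenvector of
    the symmetric matrix [A A^T], is moved to the first coordinate vectors by
    Householder reflections ([unsorted_svd_wide]), and the singular values are
    sorted at the end ([svd_exists]). *)

(** * The Frobenius inner product and orthogonal projections *)

Section FrobeniusGeometry.
Context {R : realType}.

Section InnerProduct.
Context {m n : nat}.
Implicit Types A B C : 'M[R]_(m, n).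

Lemma innerC A B : inner A B = inner B A.
Proof. by rewrite /inner -mxtrace_tr trmx_mul trmxK. Qed.

Lemma innerDr A B C : inner A (B + C) = inner A B + inner A C.
Proof. by rewrite /inner mulmxDr raddfD. Qed.

Lemma innerNr A B : inner A (- B) = - inner A B.
Proof. by rewrite /inner mulmxN raddfN. Qed.

Lemma innerZr a A B : inner A (a *: B) = a * inner A B.
Proof. by rewrite /inner -scalemxAr mxtraceZ. Qed.

Lemma innerDl A B C : inner (B + C) A = inner B A + inner C A.
Proof. by rewrite -!(innerC A) innerDr. Qed.

Lemma innerNl A B : inner (- B) A = - inner B A.
Proof. by rewrite -!(innerC A) innerNr. Qed.

Lemma innerZl a A B : inner (a *: B) A = a * inner B A.
Proof. by rewrite -!(innerC A) innerZr. Qed.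

Definition inner_lin := (innerDl, innerDr, innerNl, innerNr, innerZl, innerZr).

Lemma inner0l A : inner 0 A = 0.
Proof. by rewrite /inner trmx0 mul0mx mxtrace0. Qed.

Lemma inner0r A : inner A 0 = 0.
Proof. by rewrite innerC inner0l. Qed.

Lemma innerE A B : inner A B = \sum_j \sum_i A i j * B i j.
Proof.
apply: eq_bigr => j _; rewrite !mxE; apply: eq_bigr => i _.
by rewrite !mxE.
Qed.

Lemma inner_ge0 A : 0 <= inner A A.
Proof.
by rewrite innerE; apply: sumr_ge0 => j _; apply: sumr_ge0 => i _; exact: sqr_ge0.
Qed.

Lemma inner_eq0 A : inner A A = 0 -> A = 0.
Proof.
move=> A0; apply/matrixP => i j; rewrite mxE; apply/eqP.
rewrite -sqrf_eq0 expr2 eq_le sqr_ge0 andbT -[leRHS]A0 innerE.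
rewrite (bigD1 j) //= (bigD1 i) //= -addrA lerDl addr_ge0 //.
  by apply: sumr_ge0 => k _; exact: sqr_ge0.
by apply: sumr_ge0 => l _; apply: sumr_ge0 => k _; exact: sqr_ge0.
Qed.

Lemma frob_ge0 A : 0 <= frob A.
Proof. exact: sqrtr_ge0. Qed.

Lemma frob_sqr A : frob A ^+ 2 = inner A A.
Proof. by rewrite sqr_sqrtr // inner_ge0. Qed.

Lemma frob_eq0 A : frob A = 0 -> A = 0.
Proof. by move=> A0; apply: inner_eq0; rewrite -frob_sqr A0 expr0n. Qed.

Lemma frobN A : frob (- A) = frob A.
Proof. by rewrite /frob !inner_lin opprK. Qed.

Lemma frob_le A (x : R) : 0 <= x -> inner A A <= x ^+ 2 -> frob A <= x.
Proof. by move=> x0; rewrite -frob_sqr ler_sqr // nnegrE frob_ge0. Qed.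

Lemma inner_le_frob A B : inner A B <= frob A * frob B.
Proof.
have a0 := frob_ge0 A; have b0 := frob_ge0 B.
have [/eqP|a_neq0] := eqVneq (frob A) 0.
  by move=> /eqP a_eq0; rewrite a_eq0 mul0r (frob_eq0 a_eq0) inner0l.
have [/eqP|b_neq0] := eqVneq (frob B) 0.
  by move=> /eqP b_eq0; rewrite b_eq0 mulr0 (frob_eq0 b_eq0) inner0r.
have ab_gt0 : 0 < frob A * frob B by rewrite mulr_gt0 // lt_def ?a_neq0 ?b_neq0.
have := inner_ge0 (frob B *: A - frob A *: B).
rewrite !inner_lin -!frob_sqr (innerC B A) => h.
rewrite -(ler_pM2l ab_gt0).
by nra.
Qed.

Lemma frob_triangle A B : frob (A + B) <= frob A + frob B.
Proof.
apply: frob_le; first by rewrite addr_ge0 ?frob_ge0.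
rewrite !inner_lin -!frob_sqr (innerC B A); have := inner_le_frob A B; nra.
Qed.

End InnerProduct.

Lemma inner_mull m n p (C : 'M[R]_(m, n)) (A : 'M_(n, p)) B :
  inner (C *m A) B = inner A (C^T *m B).
Proof. by rewrite /inner trmx_mul mulmxA. Qed.

Lemma inner_mulr m n p (A : 'M[R]_(m, n)) (C : 'M_(n, p)) B :
  inner (A *m C) B = inner A (B *m C^T).
Proof. by rewrite /inner trmx_mul -mulmxA mxtrace_mulC mulmxA. Qed.

Lemma inner_tr m n (A B : 'M[R]_(m, n)) : inner A^T B^T = inner A B.
Proof. by rewrite /inner trmxK mxtrace_mulC -mxtrace_tr trmx_mul trmxK. Qed.

Lemma frob_tr m n (A : 'M[R]_(m, n)) : frob A^T = frob A.
Proof. by rewrite /frob inner_tr. Qed.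

Lemma frob_mul m n p (A : 'M[R]_(m, n)) (B : 'M_(n, p)) :
  frob (A *m B) <= frob A * frob B.
Proof.
apply: frob_le; first by rewrite mulr_ge0 ?frob_ge0.
rewrite exprMn !frob_sqr innerE.
have -> : inner A A = \sum_i inner (row i A)^T (row i A)^T.
  rewrite -inner_tr innerE; apply: eq_bigr => i _.
  by rewrite innerE big_ord1; apply: eq_bigr => k _; rewrite !mxE.
have -> : inner B B = \sum_j inner (col j B) (col j B).
  rewrite innerE; apply: eq_bigr => j _.
  by rewrite innerE big_ord1; apply: eq_bigr => k _; rewrite !mxE.
rewrite mulr_sumr; apply: ler_sum => j _; rewrite mulr_suml; apply: ler_sum => i _.
have -> : (A *m B) i j = inner (row i A)^T (col j B).
  by rewrite innerE big_ord1 mxE; apply: eq_bigr => k _; rewrite !mxE.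
rewrite -expr2 -!frob_sqr -exprMn -[leLHS]real_normK ?num_real //.
rewrite lerXn2r ?nnegrE ?mulr_ge0 ?frob_ge0 // ler_norml inner_le_frob andbT.
by rewrite lerNl -innerNl -[frob (row i A)^T]frobN inner_le_frob.
Qed.

(** Orthogonal projections, as symmetric idempotent matrices. *)
Definition orth_proj n (P : 'M[R]_n) : Prop := P^T = P /\ P *m P = P.

Lemma orth_proj_compl n (P : 'M[R]_n) : orth_proj P -> orth_proj (1%:M - P).
Proof.
case=> PT PP; split; first by rewrite linearB /= trmx1 PT.
by rewrite mulmxBl !mulmxBr !mul1mx mulmx1 PP subrr subr0.
Qed.

Lemma mulmx_compl n (P : 'M[R]_n) : orth_proj P -> P *m (1%:M - P) = 0.
Proof. by case=> _ PP; rewrite mulmxBr mulmx1 PP subrr. Qed.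

Lemma mulmx_complV n (P : 'M[R]_n) : orth_proj P -> (1%:M - P) *m P = 0.
Proof. by case=> _ PP; rewrite mulmxBl mul1mx PP subrr. Qed.

Lemma orth_proj_frame m n (U : 'M[R]_(m, n)) (J : 'M_n) :
  U^T *m U = 1%:M -> orth_proj J -> orth_proj (U *m J *m U^T).
Proof.
move=> UU [JT JJ]; split; first by rewrite !trmx_mul trmxK JT mulmxA.
by rewrite -!mulmxA (mulmxA U^T) UU mul1mx (mulmxA J) JJ.
Qed.

Lemma orth_proj_range m n (U : 'M[R]_(m, n)) :
  U^T *m U = 1%:M -> orth_proj (U *m U^T).
Proof.
move=> UU; rewrite -[U in U *m _]mulmx1; apply: orth_proj_frame => //.
by split; rewrite ?trmx1 ?mulmx1.
Qed.

Section Projections.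
Context {m n : nat}.
Implicit Types (A B : 'M[R]_(m, n)).

Lemma inner_proj (P : 'M[R]_m) A B :
  orth_proj P -> inner (P *m A) (P *m B) = inner A (P *m B).
Proof. by case=> PT PP; rewrite inner_mull mulmxA PT PP. Qed.

Lemma pythagoras (P : 'M[R]_m) A : orth_proj P ->
  inner A A = inner (P *m A) (P *m A) + inner ((1%:M - P) *m A) ((1%:M - P) *m A).
Proof.
move=> Pp; have Qp := orth_proj_compl Pp.
by rewrite !inner_proj // -innerDr -mulmxDl subrKC mul1mx.
Qed.

Lemma inner_proj_le (P : 'M[R]_m) A :
  orth_proj P -> inner (P *m A) (P *m A) <= inner A A.
Proof. by move=> Pp; rewrite [leRHS](pythagoras A Pp) lerDl inner_ge0. Qed.

End Projections.

Lemma inner_projr_le m n (Q : 'M[R]_n) (A : 'M_(m, n)) :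
  orth_proj Q -> inner (A *m Q) (A *m Q) <= inner A A.
Proof.
move=> Qp; rewrite -inner_tr -[leRHS]inner_tr trmx_mul; case: (Qp) => -> _.
exact: inner_proj_le.
Qed.

Lemma frob_proj_le m n (P : 'M[R]_m) (A : 'M_(m, n)) :
  orth_proj P -> frob (P *m A) <= frob A.
Proof. by move=> Pp; rewrite frob_le ?frob_ge0 ?frob_sqr ?inner_proj_le. Qed.

Lemma frob_projr_le m n (Q : 'M[R]_n) (A : 'M_(m, n)) :
  orth_proj Q -> frob (A *m Q) <= frob A.
Proof. by move=> Qp; rewrite frob_le ?frob_ge0 ?frob_sqr ?inner_projr_le. Qed.

Lemma inner_frame m n p (U : 'M[R]_(m, n)) (A B : 'M_(n, p)) :
  U^T *m U = 1%:M -> inner (U *m A) (U *m B) = inner A B.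
Proof. by move=> UU; rewrite inner_mull mulmxA UU mul1mx. Qed.

Lemma frob_frame m n p (U : 'M[R]_(m, n)) (A : 'M_(n, p)) :
  U^T *m U = 1%:M -> frob (U *m A) = frob A.
Proof. by move=> UU; rewrite /frob inner_frame. Qed.

Lemma frob_frame_tr m n p (U : 'M[R]_(m, n)) (A : 'M_(p, n)) :
  U^T *m U = 1%:M -> frob (A *m U^T) = frob A.
Proof. by move=> UU; rewrite -frob_tr trmx_mul trmxK frob_frame // frob_tr. Qed.

(** A frame contracts: [U *m U^T] is an orthogonal projection. *)
Lemma inner_frameT_le m n p (U : 'M[R]_(m, n)) (A : 'M_(m, p)) :
  U^T *m U = 1%:M -> inner (U^T *m A) (U^T *m A) <= inner A A.
Proof.
move=> UU; rewrite -(inner_frame _ _ UU) mulmxA.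
exact/inner_proj_le/orth_proj_range.
Qed.

(** The projection onto the tangent space attached to a pair of column and row
   projections. *)
Definition tproj m n (P : 'M[R]_m) (Q : 'M[R]_n) (A : 'M_(m, n)) :=
  P *m A + A *m Q - P *m A *m Q.

Section TangentProjection.
Context {m n : nat} (P : 'M[R]_m) (Q : 'M[R]_n).
Hypotheses (Pp : orth_proj P) (Qp : orth_proj Q).
Implicit Types (A B : 'M[R]_(m, n)).

Lemma tproj_compl A : A - tproj P Q A = (1%:M - P) *m A *m (1%:M - Q).
Proof.
rewrite /tproj mulmxBl mul1mx mulmxBr mulmx1 mulmxBl.
by rewrite !opprD !opprK !addrA.
Qed.

Lemma tproj_split A : tproj P Q A = P *m A + (1%:M - P) *m A *m Q.
Proof. by rewrite /tproj !mulmxBl mul1mx -addrA. Qed.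

Lemma tprojB A B : tproj P Q (A - B) = tproj P Q A - tproj P Q B.
Proof.
rewrite /tproj !(mulmxBl, mulmxBr) [_ - _ + (_ - _)]addrACA -opprD.
rewrite opprB [P *m B *m Q - _]addrC addrACA; congr (_ + _).
by rewrite opprB addrC.
Qed.

Lemma tproj_id A : P *m A = A -> A *m Q = A -> tproj P Q A = A.
Proof. by move=> PA AQ; rewrite /tproj PA AQ addrK. Qed.

Lemma inner_tproj A B : inner (tproj P Q A) B = inner A (tproj P Q B).
Proof.
have [[PT _] [QT _]] := (Pp, Qp).
by rewrite /tproj !inner_lin (inner_mulr A) (inner_mulr (P *m A)) !inner_mull PT QT mulmxA.
Qed.

Lemma inner_tproj_sqr A : inner (tproj P Q A) (tproj P Q A) =
  inner (P *m A) (P *m A) + inner ((1%:M - P) *m A *m Q) ((1%:M - P) *m A *m Q).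
Proof.
have orth : inner (P *m A) ((1%:M - P) *m A *m Q) = 0.
  by rewrite inner_mull (proj1 Pp) !mulmxA (mulmx_compl Pp) !mul0mx inner0r.
by rewrite tproj_split !inner_lin (innerC _ (P *m A)) orth addr0 add0r.
Qed.

Lemma inner_tproj_sqr_le2 A : inner (tproj P Q A) (tproj P Q A) <=
  inner (P *m A) (P *m A) + inner (A *m Q) (A *m Q).
Proof.
rewrite inner_tproj_sqr lerD2l -mulmxA inner_proj_le //.
exact: orth_proj_compl.
Qed.

Lemma inner_tproj_sqr_le A : inner (tproj P Q A) (tproj P Q A) <= inner A A.
Proof.
rewrite inner_tproj_sqr [leRHS](pythagoras _ Pp) lerD2l.
exact: inner_projr_le.
Qed.

Lemma inner_tproj_compl A B :
  inner (tproj P Q A) ((1%:M - P) *m B *m (1%:M - Q)) = 0.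
Proof.
rewrite inner_tproj -[RHS](inner0r A); congr inner.
rewrite /tproj !mulmxA (mulmx_compl Pp) !mul0mx add0r.
by rewrite -!mulmxA (mulmx_complV Qp) !mulmx0 subr0.
Qed.

End TangentProjection.

End FrobeniusGeometry.

(** * Existence of singular value decompositions *)

Section SingularValueDecomposition.
Context {R : realType}.

Lemma map_Re_mul m n p (A : 'M[R[i]]_(m, n)) (B : 'M[R]_(n, p)) :
  map_mx (@complex.Re R) (A *m map_mx (real_complex R) B) =
  map_mx (@complex.Re R) A *m B.
Proof.
apply/matrixP => i j; rewrite !mxE raddf_sum; apply: eq_bigr => k _.
by rewrite !mxE; case: (A i k) => a b /=; ring.
Qed.

Lemma map_Im_mul m n p (A : 'M[R[i]]_(m, n)) (B : 'M[R]_(n, p)) :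
  map_mx (@complex.Im R) (A *m map_mx (real_complex R) B) =
  map_mx (@complex.Im R) A *m B.
Proof.
apply/matrixP => i j; rewrite !mxE raddf_sum; apply: eq_bigr => k _.
by rewrite !mxE; case: (A i k) => a b /=; ring.
Qed.

(** The real and imaginary parts of a complex eigenvector span an invariant
    plane, on which symmetry forces the eigenvalue to be real. *)
Lemma symmetric_eigen n (A : 'M[R]_n.+1) : A^T = A ->
  exists (l : R) (v : 'rV_n.+1), v != 0 /\ v *m A = l *: v.
Proof.
move=> AT; pose Ac := map_mx (real_complex R) A.
have /closed_rootP [[b c]] : size (char_poly Ac) != 1%N.
  by rewrite size_char_poly.
rewrite -eigenvalue_root_char => /eigenvalueP [v vA v0].
pose x := map_mx (@complex.Re R) v; pose y := map_mx (@complex.Im R) v.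
have xA : x *m A = b *: x - c *: y.
  rewrite -map_Re_mul vA; apply/matrixP => i j; rewrite !mxE.
  by case: (v i j).
have yA : y *m A = b *: y + c *: x.
  rewrite -map_Im_mul vA; apply/matrixP => i j; rewrite !mxE.
  by case: (v i j).
have xy0 : x = 0 -> y = 0 -> v = 0.
  move=> /matrixP x0 /matrixP y0; apply/matrixP => i j.
  move: (x0 i j) (y0 i j); rewrite !mxE; case: (v i j) => a d /= -> -> //.
have c0 : c = 0.
  have := inner_mulr x A y; rewrite AT xA yA !inner_lin => /eqP h.
  have : c * (inner x x + inner y y) == 0 by apply/eqP; move/eqP: h; lra.
  rewrite mulf_eq0 paddr_eq0 ?inner_ge0 // => /orP [/eqP //|/andP [/eqP hx /eqP hy]].
  by move: v0; rewrite (xy0 (inner_eq0 hx) (inner_eq0 hy)) eqxx.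
have [x0|x0] := eqVneq x 0; last by exists b, x; rewrite xA c0 scale0r subr0.
exists b, y; rewrite yA c0 scale0r addr0; split=> //.
by apply: contra_neq v0 => y0; exact: xy0.
Qed.

Lemma unit_vector n (v : 'rV[R]_n) :
  v != 0 -> inner ((frob v)^-1 *: v) ((frob v)^-1 *: v) = 1.
Proof.
move=> v0; rewrite !inner_lin -frob_sqr mulrA -expr2 exprVn mulVf //.
by rewrite expf_eq0 /=; apply: contra_neq v0; exact: frob_eq0.
Qed.

(** The hypothesis [m <= n] makes room for a null vector [v] of [A] when the
    eigenvalue of [A *m A^T] that is found is zero. *)
Lemma singular_pair m n (A : 'M[R]_(m.+1, n.+1)) : (m <= n)%N ->
  exists (s : R) (u : 'rV_m.+1) (v : 'rV_n.+1),
  [/\ 0 <= s, inner u u = 1, inner v v = 1, u *m A = s *: v & v *m A^T = s *: u].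
Proof.
move=> mn; have sym : (A *m A^T)^T = A *m A^T by rewrite trmx_mul trmxK.
have [l [u0 [u0_neq0 u0A]]] := symmetric_eigen sym.
pose u := (frob u0)^-1 *: u0; have uu : inner u u = 1 := unit_vector u0_neq0.
have uA : u *m (A *m A^T) = l *: u by rewrite -scalemxAl u0A !scalerA mulrC.
have uAuA : inner (u *m A) (u *m A) = l.
  by rewrite inner_mulr -mulmxA uA innerZr uu mulr1.
have l_ge0 : 0 <= l by rewrite -uAuA inner_ge0.
have [l0|l_neq0] := eqVneq l 0.
  have uA0 : u *m A = 0 by apply: inner_eq0; rewrite uAuA.
  have /rowV0Pn [v0 /sub_kermxP v0A v0_neq0] : kermx A^T != 0.
    rewrite kermx_eq0 /row_free mxrank_tr; apply/negP => /eqP rA.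
    have /row_freeP [B AB] : row_free A.
      by rewrite /row_free eqn_leq rank_leq_row rA.
    have : inner u u = 0 by rewrite -[u]mulmx1 -AB mulmxA uA0 mul0mx inner0l.
    by rewrite uu => /eqP; rewrite oner_eq0.
  exists 0, u, ((frob v0)^-1 *: v0); split; rewrite ?unit_vector ?scale0r //.
  by rewrite -scalemxAl v0A scaler0.
have s0 : Num.sqrt l != 0 by rewrite sqrtr_eq0 -ltNge lt_def l_neq0.
exists (Num.sqrt l), u, ((Num.sqrt l)^-1 *: (u *m A)); split=> //.
- exact: sqrtr_ge0.
- by rewrite !inner_lin uAuA mulrA -expr2 exprVn sqr_sqrtr // mulVf.
- by rewrite scalerA mulfV // scale1r.
- rewrite -scalemxAl -mulmxA uA scalerA; congr (_ *: _).
  by rewrite -{2}(sqr_sqrtr l_ge0) expr2 mulKf.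
Qed.

(** A Householder reflection. *)
Lemma householder n (e u : 'cV[R]_n) : inner e e = inner u u ->
  exists H : 'M[R]_n, [/\ H^T = H, H *m H = 1%:M & H *m e = u].
Proof.
move=> eu; have [<-|neq] := eqVneq e u.
  by exists 1%:M; rewrite trmx1 !mul1mx.
pose w := u - e; pose c := 2 / inner w w.
have ww0 : inner w w != 0.
  by apply: contra_neq neq => /inner_eq0 /subr0_eq.
have scal (x : 'cV[R]_n) : w^T *m x = (inner w x)%:M.
  by rewrite [LHS]mx11_scalar -trace_mx11.
exists (1%:M - c *: (w *m w^T)); split.
- by rewrite linearB linearZ /= trmx1 trmx_mul trmxK.
- rewrite mulmxBl mul1mx mulmxBr mulmx1 -scalemxAl -scalemxAr.
  rewrite -[w *m w^T *m _]mulmxA (mulmxA w^T) scal mul_scalar_mx -scalemxAr.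
  have -> : c *: (inner w w *: (w *m w^T)) = w *m w^T + w *m w^T.
    by rewrite scalerA divfK // scaler_nat mulr2n.
  by rewrite scalerDr opprB addrK subrK.
- rewrite mulmxBl mul1mx -scalemxAl -mulmxA scal mul_mx_scalar scalerA.
  have -> : c * inner w e = -1.
    rewrite /c mulrAC; apply: (canLR (mulfK ww0)).
    by rewrite /w !inner_lin (innerC u e) eu; ring.
  by rewrite scaleN1r opprK /w addrC subrK.
Qed.


(** [A] is [U diag(s) V^T] with the singular values in arbitrary order. *)
Definition unsorted_svd m n k (A : 'M[R]_(m, n)) : Prop :=
  exists (U : 'M[R]_(m, k)) (s : 'rV[R]_k) (V : 'M[R]_(n, k)),
  [/\ U^T *m U = 1%:M, V^T *m V = 1%:M, forall i, 0 <= s 0 i &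
      A = U *m diag_mx s *m V^T].

Lemma unsorted_svd_wide m n (A : 'M[R]_(m, n)) :
  (m <= n)%N -> unsorted_svd m A.
Proof.
elim: m n A => [|m IHm] n A mn.
  exists 0, 0, 0; split; try by [apply/matrixP => -[] | case].
case: n A mn => // n A; rewrite ltnS => mn.
have [s [u [v [s_ge0 uu vv uA vA]]]] := singular_pair A mn.
have ee k : inner (col_mx 1%:M 0 : 'cV[R]_(1 + k)) (col_mx 1%:M 0) = 1.
  by rewrite /inner tr_col_mx mul_row_col trmx1 mulmx1 mulmx0 addr0 mxtrace1.
have [|H1 [H1T H1H H1e]] := householder (e := col_mx 1%:M 0 : 'cV_(1 + m)) (u := u^T).
  by rewrite inner_tr ee uu.
have [|H2 [H2T H2H H2e]] := householder (e := col_mx 1%:M 0 : 'cV_(1 + n)) (u := v^T).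
  by rewrite inner_tr ee vv.
pose B : 'M[R]_(1 + m, 1 + n) := H1 *m A *m H2.
have BE : A = H1 *m B *m H2 by rewrite /B !mulmxA H1H mul1mx -mulmxA H2H mulmx1.
have Be : B *m col_mx 1%:M 0 = s *: col_mx 1%:M 0.
  rewrite /B -mulmxA H2e -mulmxA -[A *m v^T]trmxK trmx_mul trmxK vA linearZ /=.
  by rewrite -H1e -scalemxAr mulmxA H1H mul1mx.
have BTe : B^T *m col_mx 1%:M 0 = s *: col_mx 1%:M 0.
  rewrite /B !trmx_mul H1T H2T -!mulmxA H1e -trmx_mul uA linearZ /=.
  by rewrite -H2e -scalemxAr mulmxA H2H mul1mx.
have BD : B = block_mx s%:M 0 0 (drsubmx B).
  move: Be; rewrite -{1}[B]submxK mul_block_col !mulmx0 !addr0 !mulmx1.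
  rewrite scale_col_mx scaler0 scalemx1 => /eq_col_mx [Bul Bdl].
  move: BTe; rewrite -{1}[B]submxK tr_block_mx mul_block_col !mulmx0 !addr0.
  rewrite !mulmx1 scale_col_mx scaler0 => /eq_col_mx [_ Bur].
  by rewrite -{1}[B]submxK Bul Bdl -[ursubmx B]trmxK Bur trmx0.
have [U [s' [V [UU VV s'_ge0 DE]]]] := IHm n (drsubmx B) mn.
have orth p q (W : 'M[R]_(p, q)) (H : 'M_(1 + p)) : H^T = H -> H *m H = 1%:M ->
    W^T *m W = 1%:M ->
    (H *m block_mx (1%:M : 'M_1) 0 0 W)^T *m (H *m block_mx 1%:M 0 0 W) = 1%:M.
  move=> HT HH WW; rewrite trmx_mul HT -mulmxA (mulmxA H) HH mul1mx.
  rewrite tr_block_mx mulmx_block !trmx0 trmx1 !mulmx0 !mul0mx !addr0 add0r.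
  by rewrite mulmx1 WW -scalar_mx_block.
pose U1 : 'M_(1 + m) := H1 *m block_mx 1%:M 0 0 U.
pose V1 : 'M_(1 + n, 1 + m) := H2 *m block_mx 1%:M 0 0 V.
have AE : A = U1 *m diag_mx (row_mx s%:M s') *m V1^T.
  rewrite BE BD diag_mx_row trmx_mul H2T !mulmxA; congr (_ *m _).
  rewrite -!mulmxA; congr (_ *m _); rewrite tr_block_mx !mulmx_block.
  rewrite !trmx0 trmx1 !mulmx0 !mul0mx !addr0 !add0r mulmx1 mul1mx !mulmx0.
  by rewrite mulmxA -DE; congr block_mx; apply/matrixP => i j; rewrite !ord1 !mxE.
exists U1, (row_mx s%:M s'), V1; split; [exact: orth | exact: orth | | by []].
move=> i; rewrite mxE.
by case: (fintype.split _) => j //; rewrite ord1 mxE eqxx mulr1n.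
Qed.

Lemma unsorted_svd_exists m n k (A : 'M[R]_(m, n)) :
  k = minn m n -> unsorted_svd k A.
Proof.
case: (leqP m n) => mn ->; first exact: unsorted_svd_wide.
have [U [s [V [UU VV s_ge0 AE]]]] := unsorted_svd_wide A^T (ltnW mn).
exists V, s, U; split=> //.
by rewrite -[A]trmxK AE !trmx_mul trmxK tr_diag_mx mulmxA.
Qed.

Lemma diag_conj_entry m n k (U : 'M[R]_(m, k)) (s : 'rV_k) (V : 'M_(n, k)) i j :
  (U *m diag_mx s *m V^T) i j = \sum_l U i l * s 0 l * V j l.
Proof. by rewrite mul_mx_diag mxE; apply: eq_bigr => l _; rewrite !mxE. Qed.

Lemma svd_exists m n (A : 'M[R]_(m, n)) : exists U s V,
  @is_svd R m n (minn m n) A U s V.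
Proof.
have [U [s0 [V [UU VV s_ge0 AE]]]] := unsorted_svd_exists A erefl.
set k := minn m n in U s0 V UU VV s_ge0 AE *.
pose s1 := [tuple s0 0 i | i < k].
have /tuple_permP [p sE] : perm_eq (sort (fun x y : R => y <= x) s1) s1.
  by rewrite perm_sort.
exists (colsub p U), (sort_tuple (fun x y : R => y <= x) s1), (colsub p V).
have tE i : tnth (sort_tuple (fun x y : R => y <= x) s1) i = s0 0 (p i).
  by rewrite (tnth_nth 0) /= sE nth_mktuple tnth_mktuple.
have orth q (W : 'M[R]_(q, k)) : W^T *m W = 1%:M ->
    (colsub p W)^T *m colsub p W = 1%:M.
  move=> /matrixP WW; apply/matrixP => i j; have := WW (p i) (p j).
  rewrite !mxE (inj_eq perm_inj) => <-.
  by apply: eq_bigr => l _; rewrite !mxE.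
split; [exact: orth | exact: orth | | |].
- by apply: sort_sorted => x y; exact: le_total.
- by apply/all_tnthP => i; rewrite tE.
- apply/matrixP => i j; rewrite AE !diag_conj_entry.
  rewrite (reindex_inj (@perm_inj _ p)); apply: eq_bigr => l _.
  by rewrite !mxE tE.
Qed.

End SingularValueDecomposition.

(** * Truncated singular value decompositions *)

Section Truncation.
Context {R : realType}.

Section Diagonal.
Context {k : nat} (s : k.-tuple R).

Lemma trunc_diagE (r : nat) :
  diag_mx (\row_i if (i < r)%N then tnth s i else 0) =
  pid_mx r *m diag_mx (\row_i tnth s i) :> 'M_k.
Proof.
apply/matrixP => i j; rewrite mul_mx_diag !mxE -val_eqE /=.
by case: eqP => [/val_inj ->|_] /=; case: ltnP; rewrite ?mul1r ?mul0r.
Qed.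

Lemma trunc_diagEr (r : nat) :
  diag_mx (\row_i if (i < r)%N then tnth s i else 0) =
  diag_mx (\row_i tnth s i) *m pid_mx r :> 'M_k.
Proof.
apply/matrixP => i j; rewrite mul_diag_mx !mxE -val_eqE /=.
by case: eqP => [/val_inj ->|_] /=; case: ltnP; rewrite ?mulr1 ?mulr0.
Qed.

Lemma orth_proj_pid (r : nat) : orth_proj (pid_mx r : 'M[R]_k).
Proof.
split; first exact: tr_pid_mx.
apply/matrixP => i j; rewrite mul_pid_mx !mxE minnn; congr ((_ && _)%:R).
by rewrite leq_min ltn_ord.
Qed.

Lemma inner_diag m (X : 'M[R]_(m, k)) (d : 'rV_k) :
  inner (X *m diag_mx d) (X *m diag_mx d) =
  \sum_i d 0 i ^+ 2 * inner (col i X) (col i X).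
Proof.
rewrite innerE; apply: eq_bigr => j _; rewrite innerE big_ord1 mulr_sumr.
by apply: eq_bigr => l _; rewrite mul_mx_diag !mxE; ring.
Qed.

Lemma inner_cols m (X : 'M[R]_(m, k)) :
  inner X X = \sum_i inner (col i X) (col i X).
Proof.
rewrite innerE; apply: eq_bigr => j _; rewrite innerE big_ord1.
by apply: eq_bigr => l _; rewrite !mxE.
Qed.

End Diagonal.

Section SVD.
Context {m n k : nat} (A : 'M[R]_(m, n)).
Context {U : 'M[R]_(m, k)} {s : k.-tuple R} {V : 'M[R]_(n, k)}.
Hypothesis svdA : is_svd A U s V.

Lemma svd_ge0 i : 0 <= tnth s i.
Proof. by case: svdA => _ _ _ /allP + _; apply; exact: mem_tnth. Qed.

Lemma svd_nth_ge0 i : 0 <= nth 0 s i.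
Proof.
have [ik|ki] := ltnP i k; last by rewrite nth_default // size_tuple.
by have := svd_ge0 (Ordinal ik); rewrite (tnth_nth 0).
Qed.

Lemma svd_nth_le i j : (i <= j)%N -> nth 0 s j <= nth 0 s i.
Proof.
move=> ij; have [jk|kj] := ltnP j k; last first.
  by rewrite [leLHS]nth_default ?size_tuple // svd_nth_ge0.
case: svdA => _ _ s_sorted _ _.
apply: (sorted_leq_nth (leT := fun x y : R => y <= x)) => //.
- by move=> x y z /[swap]; exact: le_trans.
- by rewrite inE size_tuple (leq_ltn_trans ij).
- by rewrite inE size_tuple.
Qed.

(** The positive singular values come first, and there are [\rank A] of them;
    only this half of the count is needed. *)
Lemma svd_rank_lt (i : 'I_k) : tnth s i != 0 -> (i < \rank A)%N.
Proof.
move=> si; case: (svdA) => UU VV _ _ AE.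
rewrite -[i.+1](@rank_pid_mx R k k) //.
pose t : 'rV[R]_k := \row_j if (j < i.+1)%N then (tnth s j)^-1 else 0.
have -> : pid_mx i.+1 = diag_mx t *m U^T *m A *m V :> 'M[R]_k.
  rewrite AE !mulmxA -(mulmxA _ U^T) UU mulmx1 -mulmxA VV mulmx1.
  apply/matrixP => a b; rewrite mul_diag_mx !mxE.
  rewrite -val_eqE /=; case: eqP => _ /=; last by rewrite mulr0.
  case: ltnP => [ai|_]; last by rewrite mul0r.
  rewrite mulVf // gt_eqF // (lt_le_trans (y := tnth s i)) //.
    by rewrite lt_def si svd_ge0.
  by rewrite !(tnth_nth 0) svd_nth_le.
by rewrite (leq_trans (mxrankM_maxl _ _)) // mxrankM_maxr.
Qed.

(** Truncation at a rank that [A] does not exceed leaves [A] unchanged. *)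
Lemma svd_trunc_low_rank r : (\rank A <= r)%N ->
  A = U *m pid_mx r *m U^T *m A.
Proof.
move=> rA; case: (svdA) => UU _ _ _ AE.
rewrite {2}AE !mulmxA -(mulmxA _ U^T) UU mulmx1 -(mulmxA U) -trunc_diagE.
rewrite [LHS]AE; congr (_ *m diag_mx _ *m _); apply/rowP => i; rewrite !mxE.
case: ltnP => // ri; apply/eqP; apply: contraTT rA => /svd_rank_lt.
by rewrite -ltnNge; exact: leq_ltn_trans.
Qed.

End SVD.

(** Linear programming over weights [0 <= w i <= 1]: a nonincreasing nonnegative
    sequence has its largest weighted sum when the weight sits on the first
    terms. *)
Lemma weighted_sum_le k (r : nat) (a : nat -> R) (w : 'I_k -> R) :
  (forall i, 0 <= a i) -> (forall i j, (i <= j)%N -> a j <= a i) ->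
  (forall i, 0 <= w i <= 1) ->
  \sum_(i < k) w i <= \sum_(i < k) (i < r)%:R ->
  \sum_(i < k) a i * w i <= \sum_(i < k) a i * (i < r)%:R.
Proof.
move=> a_ge0 a_mono w01 w_sum.
(* compare with the threshold [a r] that separates kept and dropped terms *)
have : \sum_(i < k) (a i - a r) * (w i - (i < r)%:R) <= 0.
  apply: sumr_le0 => i _; have := w01 i.
  case: ltnP => [/ltnW ir|ri] => /andP [w0 w1] /=.
    by rewrite mulr_ge0_le0 // ?subr_ge0 ?a_mono // subr_le0.
  by rewrite mulr_le0_ge0 // ?subr_le0 ?a_mono // subr_ge0.
have -> : \sum_(i < k) (a i - a r) * (w i - (i < r)%:R) =
    (\sum_(i < k) a i * w i - \sum_(i < k) a i * (i < r)%:R)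
    - a r * (\sum_(i < k) w i - \sum_(i < k) (i < r)%:R).
  rewrite -!sumrB mulr_sumr -sumrB; apply: eq_bigr => i _; ring.
have := a_ge0 r; nra.
Qed.

Section TruncatedSVD.
Context {m n : nat}.
Implicit Types A B G N : 'M[R]_(m, n).

(** [svd_trunc r G] is a genuine truncation, because [G] has an SVD. *)
Lemma frob_trunc_attained r G :
  exists2 B, is_svd_trunc r G B & frob_trunc r G = frob B.
Proof.
exists (svd_trunc r G) => //; apply: (@xgetPex _ 0 [set B | is_svd_trunc r G B]%classic).
have [U [s [V svdG]]] := svd_exists G.
by exists (U *m diag_mx (\row_i if (i < r)%N then tnth s i else 0) *m V^T), U, s, V.
Qed.

Lemma trunc_proj r N B : is_svd_trunc r N B -> exists P Q,
  [/\ orth_proj P, orth_proj Q, P *m N = B & N *m Q = B].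
Proof.
move=> [U [s [V [[UU VV _ _ ->] ->]]]].
exists (U *m pid_mx r *m U^T), (V *m pid_mx r *m V^T).
split; try by apply: orth_proj_frame => //; exact: orth_proj_pid.
- by rewrite !mulmxA -(mulmxA _ U^T) UU mulmx1 -(mulmxA U) -trunc_diagE.
- by rewrite -!mulmxA (mulmxA V^T) VV mul1mx (mulmxA _ (pid_mx r)) -trunc_diagEr.
Qed.

(** Among the matrices of rank at most [r], the truncated SVD captures the
    largest part of [G]. *)
Lemma inner_le_trunc r G B A : is_svd_trunc r G B -> (\rank A <= r)%N ->
  inner G A <= frob B * frob A.
Proof.
move=> [U [s [V [svdG BE]]]] rA.
(* [A] is supported on a projection [Q] of rank at most [r], so only [Q *m G]
   matters; its squared norm is a weighted sum of squared singular values *)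
have [W [t [Z svdA]]] := svd_exists A.
have AE := svd_trunc_low_rank svdA rA.
set Q := W *m pid_mx r *m W^T in AE.
case: (svdA) => WW _ _ _ _; case: (svdG) => UU VV _ _ GE.
have Qp : orth_proj Q by apply: orth_proj_frame => //; exact: orth_proj_pid.
rewrite AE innerC inner_mull (proj1 Qp) innerC -AE.
apply: le_trans (inner_le_frob _ _) _; apply: ler_wpM2r; first exact: frob_ge0.
apply: frob_le; first exact: frob_ge0.
rewrite frob_sqr BE GE mulmxA -/(frob _) -!frob_sqr !frob_frame_tr // !frob_sqr.
rewrite mulmxA !inner_diag.
pose w i := inner (col i (Q *m U)) (col i (Q *m U)).
have -> : \sum_(i < minn m n) (\row_i tnth s i) 0 i ^+ 2 * inner (col i (Q *m U)) (col i (Q *m U))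
    = \sum_(i < minn m n) (nth 0 s i) ^+ 2 * w i.
  by apply: eq_bigr => i _; rewrite mxE (tnth_nth 0).
have colU i : inner (col i U) (col i U) = 1.
  have <- : (U^T *m U) i i = 1 by rewrite UU mxE eqxx.
  by rewrite mxE innerE big_ord1; apply: eq_bigr => l _; rewrite !mxE.
have -> : \sum_(i < minn m n) (\row_i (if (i < r)%N then tnth s i else 0)) 0 i ^+ 2 *
    inner (col i U) (col i U) = \sum_(i < minn m n) (nth 0 s i) ^+ 2 * (i < r)%:R.
  apply: eq_bigr => i _; rewrite colU !mxE (tnth_nth 0).
  by case: ltnP; rewrite ?mulr1 // expr0n mulr0.
apply: (weighted_sum_le (a := fun i => nth 0 s i ^+ 2)) => [i|i j ij|i|].
- exact: sqr_ge0.
- by rewrite lerXn2r ?nnegrE ?(svd_nth_ge0 svdG) ?(svd_nth_le svdG).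
- by rewrite /w inner_ge0 -(colU i) colE -mulmxA -colE inner_proj_le.
(* the weights [w] add up to the squared norm of [pid_mx r *m W^T *m U], which is
   at most that of [pid_mx r] *)
rewrite -inner_cols -!mulmxA inner_frame //.
rewrite -inner_tr !trmx_mul !trmxK tr_pid_mx -mulmxA.
have -> : \sum_(i < minn m n) (i < r)%:R =
    inner (pid_mx r : 'M[R]_(minn m n)) (pid_mx r).
  rewrite inner_cols; apply: eq_bigr => i _; rewrite innerE big_ord1.
  rewrite (bigD1 i) //= big1 ?addr0 => [|j ji]; rewrite !mxE.
    by rewrite eqxx; case: (i < r)%N; rewrite ?mulr1 ?mulr0.
  by move: ji; rewrite -val_eqE => /negbTE /= ->; rewrite mulr0.
rewrite -[leRHS](inner_frame _ _ WW).
exact: inner_frameT_le.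
Qed.

End TruncatedSVD.

End Truncation.

(** * Perturbation of the truncation, and the tangent step *)

Section Perturbation.
Context {R : realType} {m n : nat} (r : nat) (Ms : 'M[R]_(m, n)).
Hypotheses (r_gt0 : (0 < r)%N) (rankMs : \rank Ms = r).
Implicit Types (A B N : 'M[R]_(m, n)).

(** In an SVD of [Ms], every nonzero singular value is at least [sigma r Ms]. *)
Lemma sigma_svd : exists U V (s : (minn m n).-tuple R),
  [/\ is_svd Ms U s V, 0 <= sigma r Ms &
      forall i, tnth s i = 0 \/ sigma r Ms <= tnth s i].
Proof.
have [U [V svdMs]] : exists U V, is_svd Ms U (singular_values Ms) V.
  apply: (@xgetPex _ _ [set s | exists U V, is_svd Ms U s V]%classic).
  by have [U [s [V svdMs]]] := svd_exists Ms; exists s, U, V.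
exists U, V, (singular_values Ms); split=> // [|i].
  exact: (svd_nth_ge0 svdMs).
have [->|si] := eqVneq (tnth (singular_values Ms) i) 0; [by left | right].
rewrite (tnth_nth 0); apply: (svd_nth_le svdMs).
by rewrite -ltnS (prednK r_gt0) -rankMs (svd_rank_lt svdMs).
Qed.

(** When [P] and [Q] fix [B], the part of [Ms] normal to them is of second order in
    [Ms - B]. *)
Lemma complement_bound (P : 'M[R]_m) (Q : 'M[R]_n) B :
  orth_proj P -> orth_proj Q -> P *m B = B -> B *m Q = B ->
  sigma r Ms * frob ((1%:M - P) *m Ms *m (1%:M - Q)) <= frob (Ms - B) ^+ 2.
Proof.
move=> Pp Qp PB BQ; have [U [V [s [svdMs sig_ge0 gap]]]] := sigma_svd.
case: (svdMs) => UU VV _ _ MsE; set S := diag_mx _ in MsE.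
have Pp' := orth_proj_compl Pp; have Qp' := orth_proj_compl Qp.
set P' := 1%:M - P in Pp' *; set Q' := 1%:M - Q in Qp' *.
(* [diag_mx d] is [sigma r Ms] times the pseudo-inverse of [S]: the convention
   [0^-1 = 0] makes the quotient vanish where [S] does *)
pose d : 'rV[R]_(minn m n) := \row_i (sigma r Ms / tnth s i).
pose X := P' *m U *m S; pose Y := S *m V^T *m Q'.
have SdS : S *m diag_mx d *m S = sigma r Ms *: S.
  apply/matrixP => i j; rewrite !mul_mx_diag !mxE.
  case: eqVneq => [<-|_] /=; last by rewrite mulr0n !mul0r mulr0.
  rewrite mulr1n; have [->|si0] := eqVneq (tnth s i) 0; first by rewrite !mulr0.
  by rewrite mulrCA mulfV // mulr1.
have -> : sigma r Ms * frob (P' *m Ms *m Q') = frob (X *m (diag_mx d *m Y)).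
  have -> : X *m (diag_mx d *m Y) = sigma r Ms *: (P' *m Ms *m Q').
    rewrite /X /Y !mulmxA -(mulmxA (P' *m U) S) -(mulmxA (P' *m U) (S *m _)) SdS MsE.
    by rewrite -scalemxAr -!scalemxAl !mulmxA.
  by rewrite /frob !inner_lin mulrA -expr2 sqrtrM ?sqr_ge0 // sqrtr_sqr ger0_norm.
have frobX : frob X <= frob (Ms - B).
  rewrite -(frob_frame_tr X VV) /X -!mulmxA (mulmxA U) -MsE.
  have -> : P' *m Ms = P' *m (Ms - B).
    by rewrite mulmxBr -{1}PB mulmxA (mulmx_complV Pp) mul0mx subr0.
  exact: frob_proj_le.
have frobY : frob Y <= frob (Ms - B).
  rewrite -(frob_frame Y UU) /Y !mulmxA -MsE.
  have -> : Ms *m Q' = (Ms - B) *m Q'.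
    by rewrite mulmxBl -{1}BQ -mulmxA (mulmx_compl Qp) mulmx0 subr0.
  exact: frob_projr_le.
have frobdY : frob (diag_mx d *m Y) <= frob Y.
  rewrite -frob_tr -[leRHS]frob_tr trmx_mul tr_diag_mx.
  apply: frob_le; rewrite ?frob_ge0 // frob_sqr inner_diag [leRHS]inner_cols.
  apply: ler_sum => i _; rewrite ler_piMl ?inner_ge0 // mxE.
  case: (gap i) => [->|gapi]; first by rewrite invr0 mulr0 expr0n ler01.
  have si := svd_ge0 svdMs i.
  rewrite expr_le1 ?divr_ge0 //; move: gapi; case: (ltrgt0P (tnth s i)) si => // [si|->] _.
    by rewrite ler_pdivrMr // mul1r.
  by rewrite invr0 mulr0 ler01.
apply: le_trans (frob_mul _ _) _; rewrite expr2 ler_pM ?frob_ge0 //.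
exact: le_trans frobdY frobY.
Qed.

(** The Eckart-Young theorem. *)
Lemma trunc_best N B A : is_svd_trunc r N B -> (\rank A <= r)%N ->
  frob (N - B) <= frob (N - A).
Proof.
move=> trB rA; apply: frob_le; first exact: frob_ge0.
have NA := inner_le_trunc trB rA.
have [P [_ [Pp _ PN _]]] := trunc_proj trB.
have NB : inner N B = inner B B by rewrite -PN inner_proj.
rewrite frob_sqr !inner_lin (innerC B N) (innerC A N) NB -!frob_sqr.
have := sqr_ge0 (frob B - frob A); nra.
Qed.

(** Truncation increases the distance to a matrix of rank [r] by a second
    order term only: the tangential part of [N - Ms] is projected, and the normal
    part of [Ms] is quadratically small. *)
Lemma trunc_perturbation N B : is_svd_trunc r N B -> exists2 e,
  0 <= e /\ sigma r Ms * e <= 4 * frob (N - Ms) ^+ 2 &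
  frob (B - Ms) ^+ 2 <= frob (N - Ms) ^+ 2 + e ^+ 2.
Proof.
move=> trB; have [P [Q [Pp Qp PN NQ]]] := trunc_proj trB.
have PB : P *m B = B by rewrite -PN mulmxA (proj2 Pp).
have BQ : B *m Q = B by rewrite -NQ -mulmxA (proj2 Qp).
have MsB : frob (Ms - B) <= 2 * frob (N - Ms).
  have -> : Ms - B = (N - B) + - (N - Ms) by rewrite opprB [RHS]addrC subrKA.
  have := frob_triangle (N - B) (- (N - Ms)); rewrite frobN.
  have := @trunc_best N B Ms trB; rewrite rankMs leqnn => /(_ isT); lra.
exists (frob ((1%:M - P) *m Ms *m (1%:M - Q))).
  split; first exact: frob_ge0.
  apply: le_trans (complement_bound Pp Qp PB BQ) _.
  have := frob_ge0 (Ms - B); nra.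
have -> : B - Ms = tproj P Q (N - Ms) - (1%:M - P) *m Ms *m (1%:M - Q).
  rewrite tprojB -(tproj_compl P Q).
  have -> : tproj P Q N = B by rewrite /tproj PN NQ BQ addrK.
  by move: (tproj P Q Ms) => T; rewrite opprB subrKA.
have := inner_tproj_compl Pp Qp (N - Ms) Ms.
have := inner_tproj_sqr_le Pp Qp (N - Ms).
move: (tproj _ _ _) (_ *m _ *m (1%:M - Q)) => T E TT TE.
by rewrite !frob_sqr (innerDl _ T) !(innerDr _ T) !innerNl !innerNr (innerC E) TE; lra.
Qed.

End Perturbation.

Section GradientStep.
Context {R : realType} {m n : nat} (r : nat) (Ms : 'M[R]_(m, n)).
Hypotheses (r_gt0 : (0 < r)%N) (rankMs : \rank Ms = r).
Implicit Types (A B N : 'M[R]_(m, n)).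
Context (G B : 'M[R]_(m, n)) (L : R).
Hypotheses (trG : is_svd_trunc r G B) (BL : frob B <= L).

Lemma inner_trunc_le A : (\rank A <= r)%N -> inner G A <= L * frob A.
Proof.
move=> rA; apply: le_trans (inner_le_trunc trG rA) _.
by rewrite ler_wpM2r ?frob_ge0.
Qed.

Lemma frob_proj_trunc (P : 'M[R]_m) : orth_proj P -> (\rank P <= r)%N ->
  inner (P *m G) (P *m G) <= L ^+ 2.
Proof.
move=> Pp rP; have rPG : (\rank (P *m G) <= r)%N.
  exact: leq_trans (mxrankM_maxl _ _) rP.
have := inner_trunc_le rPG; rewrite -inner_proj // -frob_sqr.
have := frob_ge0 (P *m G); have := frob_ge0 B; have := BL; nra.
Qed.

Lemma frob_projr_trunc (Q : 'M[R]_n) : orth_proj Q -> (\rank Q <= r)%N ->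
  inner (G *m Q) (G *m Q) <= L ^+ 2.
Proof.
move=> [QT QQ] rQ; have rGQ : (\rank (G *m Q) <= r)%N.
  exact: leq_trans (mxrankM_maxr _ _) rQ.
have := inner_trunc_le rGQ.
have <- : inner (G *m Q) (G *m Q) = inner G (G *m Q).
  by rewrite inner_mulr QT -mulmxA QQ.
rewrite -frob_sqr.
have := frob_ge0 (G *m Q); have := frob_ge0 B; have := BL; nra.
Qed.

Section Step.
Context (M : 'M[R]_(m, n)) (P : 'M[R]_m) (Q : 'M[R]_n).
Hypotheses (Pp : orth_proj P) (Qp : orth_proj Q).
Hypotheses (PM : P *m M = M) (MQ : M *m Q = M).
Hypotheses (rP : (\rank P <= r)%N) (rQ : (\rank Q <= r)%N).

(** Sharpness and the sub-gradient bound constrain each other, because [M - Ms]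
    is the sum of two orthogonal pieces of rank at most [r]. *)
Lemma inner_diff_le : 0 <= inner G (M - Ms) ->
  inner G (M - Ms) ^+ 2 <= 2 * L ^+ 2 * frob (M - Ms) ^+ 2.
Proof.
move=> G_ge0; set D := M - Ms in G_ge0 *.
have rPD : (\rank (P *m D) <= r)%N by exact: leq_trans (mxrankM_maxl _ _) rP.
have rPD' : (\rank ((1%:M - P) *m D) <= r)%N.
  rewrite mulmxBr -{1}PM mulmxA (mulmx_complV Pp) mul0mx sub0r.
  by rewrite mxrank_opp -rankMs mxrankM_maxr.
have h1 := inner_trunc_le rPD; have h2 := inner_trunc_le rPD'.
have := pythagoras D Pp; rewrite -!frob_sqr => ->.
have GD : inner G D = inner G (P *m D) + inner G ((1%:M - P) *m D).
  by rewrite -innerDr -mulmxDl subrKC mul1mx.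
set x := frob (P *m D) in h1 *; set y := frob (_ *m D) in h2 *.
have : inner G D <= L * (x + y) by rewrite GD; lra.
move=> le; have := sqr_ge0 (L * (x - y)).
have : inner G D ^+ 2 <= (L * (x + y)) ^+ 2 by rewrite lerXn2r ?nnegrE // (le_trans G_ge0).
nra.
Qed.

(** The step along the projected sub-gradient, before truncation; [e] is the norm
    of the part of [Ms] normal to the tangent space at [M]. *)
Lemma tangent_step (eta : R) : 0 <= eta -> exists2 e,
  0 <= e /\ sigma r Ms * e <= frob (M - Ms) ^+ 2 &
  frob (M - eta *: tproj P Q G - Ms) ^+ 2 <=
    frob (M - Ms) ^+ 2 - 2 * eta * (inner G (M - Ms) - L * e)
    + 2 * eta ^+ 2 * L ^+ 2.
Proof.
move=> eta_ge0; set E := (1%:M - P) *m Ms *m (1%:M - Q).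
exists (frob E).
  split; first exact: frob_ge0.
  rewrite -[frob (M - Ms)]frobN opprB.
  exact: (complement_bound r_gt0 rankMs Pp Qp PM MQ).
have rE : (\rank (- E) <= r)%N.
  rewrite mxrank_opp -rankMs; apply: leq_trans (mxrankM_maxl _ _) _.
  exact: mxrankM_maxr.
have GE := inner_trunc_le rE; rewrite frobN innerNr in GE.
have TD : inner (tproj P Q G) (M - Ms) = inner G (M - Ms) + inner G E.
  rewrite inner_tproj // -innerDr tprojB (tproj_id PM MQ) /E -(tproj_compl P Q).
  by rewrite addrA subrK.
have TG : inner (tproj P Q G) (tproj P Q G) <= 2 * L ^+ 2.
  have := inner_tproj_sqr_le2 Q Pp G.
  have := frob_proj_trunc Pp rP; have := frob_projr_trunc Qp rQ; lra.
have -> : M - eta *: tproj P Q G - Ms = (M - Ms) - eta *: tproj P Q G.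
  by rewrite addrAC.
move: TD TG; set T := tproj P Q G; set D := M - Ms => TD TG.
rewrite !frob_sqr (innerDl _ D) !(innerDr _ D) !innerNl !innerNr !innerZl !innerZr.
rewrite (innerC D T) TD; nra.
Qed.

End Step.

End GradientStep.

(** * One iteration *)

Section OneIteration.
Context {R : realType} {d1 d2 : nat}.
Implicit Types M G : 'M[R]_(d1, d2).

Lemma mxrank_frame m k (U : 'M[R]_(m, k)) : (\rank (U *m U^T) <= k)%N.
Proof. exact: leq_trans (mxrankM_maxl _ _) (rank_leq_col _). Qed.

Lemma rsgrad_step_low_rank f r eta M G M' :
  rsgrad_step f r eta M G M' -> (\rank M <= r)%N.
Proof.
move=> [_ [U [s [V [[_ _ _ _ ->] _]]]]].
exact: leq_trans (mxrankM_maxr _ _) (rank_leq_row _).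
Qed.

(** One iteration, with sharpness gap [a] and sub-gradient bound [L]. The scalars
    [e] and [e'] are the norms of the normal parts of [Mstar] at [M] and at
    [M'], and [N2] is the squared distance before truncation. *)
Lemma rsgrad_step_bound f r Mstar M G M' (eta a L : R) :
  (0 < r)%N -> \rank Mstar = r -> rsgrad_step f r eta M G M' ->
  0 <= eta -> 0 <= a -> a <= f M - f Mstar -> frob_trunc r G <= L ->
  let d := frob (M - Mstar) in
  a ^+ 2 <= 2 * L ^+ 2 * d ^+ 2 /\
  exists e e' N2 : R,
  [/\ 0 <= e /\ sigma r Mstar * e <= d ^+ 2,
      0 <= e' /\ sigma r Mstar * e' <= 4 * N2,
      0 <= N2 <= d ^+ 2 - 2 * eta * (a - L * e) + 2 * eta ^+ 2 * L ^+ 2 &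
      frob (M' - Mstar) ^+ 2 <= N2 + e' ^+ 2].
Proof.
move=> r_gt0 rankMs [subG [U [s [V [[UU VV _ _ ME] trM']]]]] eta_ge0 a_ge0 sharp.
have [B trG ->] := frob_trunc_attained r G => BL d.
set P := U *m U^T; set Q := V *m V^T.
have Pp : orth_proj P := orth_proj_range UU.
have Qp : orth_proj Q := orth_proj_range VV.
have PM : P *m M = M by rewrite /P ME !mulmxA -(mulmxA U) UU mulmx1.
have MQ : M *m Q = M by rewrite /Q ME -!mulmxA (mulmxA V^T) VV mul1mx.
have rP : (\rank P <= r)%N := mxrank_frame U.
have rQ : (\rank Q <= r)%N := mxrank_frame V.
have aG : a <= inner G (M - Mstar).
  have := subG Mstar; rewrite -(opprB M) innerNr; lra.
have TE : tangent_proj U V G = tproj P Q G by rewrite /tangent_proj /tproj !mulmxA.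
rewrite TE in trM'; have L_ge0 : 0 <= L := le_trans (frob_ge0 B) BL.
split.
  have := inner_diff_le rankMs trG BL Pp PM rP (le_trans a_ge0 aG).
  by apply: le_trans; rewrite lerXn2r ?nnegrE // (le_trans a_ge0).
have [e [e_ge0 se] step] :=
  tangent_step r_gt0 rankMs trG BL Pp Qp PM MQ rP rQ eta_ge0.
have [e' [e'_ge0 se'] trunc] := trunc_perturbation r_gt0 rankMs trM'.
exists e, e', (frob (M - eta *: tproj P Q G - Mstar) ^+ 2).
split=> //; rewrite sqr_ge0 /=; apply: le_trans step _.
by rewrite lerD2r lerD2l lerN2 ler_wpM2l ?mulr_ge0 // lerD2r.
Qed.

End OneIteration.

(** * Scalar inequalities *)

Section ScalarInequalities.
Context {R : realType}.
Implicit Types (s k E N e d : R).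

(** The initialization [E <= s k / 100] turns a bound [s e <= x] on the norm of a
    normal part into one relative to [E]. *)
Lemma normal_part_small s k E e x : 0 < s -> 0 <= k -> E <= 1 / 100 * s * k ->
  0 <= e -> s * e <= x -> E * e <= 1 / 100 * k * x.
Proof.
move=> s_gt0 k_ge0 Es e_ge0 se.
have h1 : E * e <= 1 / 100 * s * k * e by rewrite ler_wpM2r.
have h2 : k * (s * e) <= k * x by rewrite ler_wpM2l.
by lra.
Qed.

(** The cost of truncation, at most [(4 k E / 100) ^+ 2], is absorbed by the
    decrease [19 k / 100 * E ^+ 2] of the squared distance. *)
Lemma contraction s k E N e d rho : 0 < s -> 0 < E -> E <= 1 / 100 * s * k ->
  0 <= k <= 2 -> 0 <= rho <= 4 / 100 -> 0 <= d ->
  0 <= N <= E ^+ 2 * (1 - 19 / 100 * k) ->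
  0 <= e -> s * e <= 4 * N -> d ^+ 2 <= N + e ^+ 2 ->
  d <= (1 - rho * k) * E.
Proof.
move=> s_gt0 E_gt0 Es /andP [k0 k2] /andP [rho0 rho1] d_ge0 /andP [N0 N1] e0 se dN.
have Ee := normal_part_small s_gt0 k0 Es e0 se.
have NE : N <= E ^+ 2 by have := sqr_ge0 E; nra.
have eE : e <= 4 / 100 * k * E.
  rewrite -(ler_pM2l E_gt0); apply: le_trans Ee _.
  have : k * N <= k * E ^+ 2 by rewrite ler_wpM2l.
  by nra.
have e2 : e ^+ 2 <= (4 / 100 * k * E) ^+ 2.
  by rewrite lerXn2r ?nnegrE // (le_trans e0).
have kk : k ^+ 2 <= 2 * k by nra.
have rk : rho * k <= 4 / 100 * k by rewrite ler_wpM2r.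
rewrite -(@ler_pXn2r _ 2) ?nnegrE //; last first.
  by apply: mulr_ge0; [lra | exact: ltW].
rewrite exprMn; apply: le_trans dN _.
have : E ^+ 2 * ((1 - 19 / 100 * k) + (4 / 100) ^+ 2 * (2 * k)) <=
    (1 - rho * k) ^+ 2 * E ^+ 2.
  rewrite mulrC ler_wpM2r ?sqr_ge0 //.
  have := sqr_ge0 (rho * k); lra.
have : E ^+ 2 * k ^+ 2 <= E ^+ 2 * (2 * k) by rewrite ler_wpM2l ?sqr_ge0.
by move: e2; rewrite !exprMn; lra.
Qed.

Lemma ratio_le2 (mu L d : R) : 0 < L -> 0 < d ->
  (mu * d) ^+ 2 <= 2 * L ^+ 2 * d ^+ 2 -> mu ^+ 2 / L ^+ 2 <= 2.
Proof.
move=> L_gt0 d_gt0; rewrite exprMn ler_pM2r ?exprn_gt0 // => h.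
by rewrite ler_pdivrMr ?exprn_gt0.
Qed.

(** [E] is the guaranteed bound on the current distance [d]. The estimate is convex
    in [d], so that only the ends [0] and [E] of its range matter. *)
Lemma phase_one_bound (mu L E d e eta s : R) :
  let k := mu ^+ 2 / L ^+ 2 in
  0 < mu -> 0 < L -> 0 < s -> 0 < E -> E <= 1 / 100 * s * k -> k <= 2 ->
  0 <= d <= E ->
  2 / 10 * E * (mu / L ^+ 2) <= eta <= 3 / 10 * E * (mu / L ^+ 2) ->
  0 <= e -> s * e <= d ^+ 2 ->
  d ^+ 2 - 2 * eta * (mu * d - L * e) + 2 * eta ^+ 2 * L ^+ 2 <=
  E ^+ 2 * (1 - 19 / 100 * k).
Proof.
move=> k mu_gt0 L_gt0 s_gt0 E_gt0 Es k2 /andP [d0 dE] /andP [eta1 eta2] e0 se.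
have EE : 0 < E ^+ 2 by rewrite exprn_gt0.
pose q := mu / L; have kE : k = q ^+ 2 by rewrite /k /q expr_div_n.
have q0 : 0 < q by rewrite divr_gt0.
have q32 : q <= 3 / 2 by rewrite kE in k2; nra.
have k0 : 0 < k by rewrite kE exprn_gt0.
pose al := eta / (E * (mu / L ^+ 2)).
have w0 : 0 < E * (mu / L ^+ 2) by rewrite mulr_gt0 // divr_gt0 // exprn_gt0.
have al1 : 2 / 10 <= al by rewrite /al ler_pdivlMr // (mulrA (2 / 10)).
have al2 : al <= 3 / 10 by rewrite /al ler_pdivrMr // (mulrA (3 / 10)).
have L0 : L != 0 by rewrite gt_eqF.
have etaE : eta = al * (E * (mu / L ^+ 2)) by rewrite /al divfK // gt_eqF.
have Ee := normal_part_small s_gt0 (ltW k0) Es e0 se.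
have dd : d ^+ 2 <= E ^+ 2 by rewrite lerXn2r ?nnegrE // ltW.
have Ee' : E * e <= 1 / 100 * k * E ^+ 2.
  by apply: le_trans Ee _; rewrite ler_wpM2l //; lra.
have -> : d ^+ 2 - 2 * eta * (mu * d - L * e) + 2 * eta ^+ 2 * L ^+ 2 =
   d ^+ 2 - 2 * al * k * (E * d) + 2 * (al * q) * (E * e) + 2 * al ^+ 2 * k * E ^+ 2.
  by rewrite etaE /k /q; field.
have alq : al * q <= 45 / 100.
  apply: (@le_trans _ _ (3 / 10 * (3 / 2))); last by lra.
  by apply: ler_pM => //; [lra | exact: ltW].
have h1 : al * q * (E * e) <= 45 / 100 * (1 / 100 * k * E ^+ 2).
  apply: ler_pM => //; first by rewrite mulr_ge0 //; [lra | exact: ltW].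
  by rewrite mulr_ge0 // ltW.
have kE2 : 0 < k * E ^+ 2 by rewrite mulr_gt0.
(* [(al - 2 / 10) * (al - 3 / 10) <= 0] *)
have al2' : al ^+ 2 <= 5 / 10 * al - 6 / 100 by nra.
have h2 : al ^+ 2 * (k * E ^+ 2) <= (5 / 10 * al - 6 / 100) * (k * E ^+ 2).
  by rewrite ler_pM2r.
(* either [d ^+ 2 - 2 * al * k * E * d] is nonpositive, or it is at most its
   value at [d = E] *)
have [le|gt] := lerP d (2 * al * k * E).
  have : d * d <= d * (2 * al * k * E) by rewrite ler_wpM2l.
  have : k * E ^+ 2 <= 2 * E ^+ 2 by rewrite ler_wpM2r // ltW.
  have : al * (k * E ^+ 2) <= 3 / 10 * (k * E ^+ 2) by rewrite ler_pM2r.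
  by lra.
have : 0 <= (E - d) * (E + d - 2 * al * k * E) by rewrite mulr_ge0 //; lra.
have : 2 / 10 * (k * E ^+ 2) <= al * (k * E ^+ 2) by rewrite ler_pM2r.
by lra.
Qed.

Lemma phase_two_bound (mu L d e eta s : R) :
  let k := mu ^+ 2 / L ^+ 2 in
  0 < mu -> 0 < L -> 0 < s -> 0 < d -> d <= 1 / 100 * s * k -> k <= 2 ->
  125 / 1000 * (mu / L ^+ 2) <= eta <= 75 / 100 * (mu / L ^+ 2) ->
  0 <= e -> s * e <= d ^+ 2 ->
  d ^+ 2 - 2 * eta * (mu * d ^+ 2 - L * d * e) + 2 * eta ^+ 2 * (L * d) ^+ 2 <=
  d ^+ 2 * (1 - 19 / 100 * k).
Proof.
move=> k mu_gt0 L_gt0 s_gt0 d_gt0 ds k2 /andP [eta1 eta2] e0 se.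
have dd : 0 < d ^+ 2 by rewrite exprn_gt0.
pose q := mu / L; have kE : k = q ^+ 2 by rewrite /k /q expr_div_n.
have q0 : 0 < q by rewrite divr_gt0.
have q32 : q <= 3 / 2 by rewrite kE in k2; nra.
have k0 : 0 < k by rewrite kE exprn_gt0.
pose be := eta / (mu / L ^+ 2).
have w0 : 0 < mu / L ^+ 2 by rewrite divr_gt0 // exprn_gt0.
have be1 : 125 / 1000 <= be by rewrite /be ler_pdivlMr.
have be2 : be <= 75 / 100 by rewrite /be ler_pdivrMr.
have L0 : L != 0 by rewrite gt_eqF.
have etaE : eta = be * (mu / L ^+ 2) by rewrite /be divfK // gt_eqF.
have de := normal_part_small s_gt0 (ltW k0) ds e0 se.
have -> : d ^+ 2 - 2 * eta * (mu * d ^+ 2 - L * d * e) + 2 * eta ^+ 2 * (L * d) ^+ 2 =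
   d ^+ 2 - 2 * be * (k * d ^+ 2) + 2 * (be * q) * (d * e) + 2 * be ^+ 2 * (k * d ^+ 2).
  by rewrite etaE /k /q; field.
have beq : be * q <= 9 / 8.
  apply: (@le_trans _ _ (75 / 100 * (3 / 2))); last by lra.
  by apply: ler_pM => //; [lra | exact: ltW].
have h1 : be * q * (d * e) <= 9 / 8 * (1 / 100 * k * d ^+ 2).
  apply: ler_pM => //; first by rewrite mulr_ge0 //; [lra | exact: ltW].
  by rewrite mulr_ge0 // ltW.
have kd2 : 0 < k * d ^+ 2 by rewrite mulr_gt0.
(* [(be - 1 / 8) * (be - 3 / 4) <= 0] *)
have be2' : be ^+ 2 - be <= - (7 / 64) by nra.
have : (be ^+ 2 - be) * (k * d ^+ 2) <= - (7 / 64) * (k * d ^+ 2).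
  by rewrite ler_pM2r.
by lra.
Qed.

End ScalarInequalities.

(** * The two phases *)

Section Phases.
Context {R : realType} {d1 d2 r : nat} (f : 'M[R]_(d1, d2) -> R).
Context (Mstar M G M' : 'M[R]_(d1, d2)) (eta mu L : R).
Hypotheses (r_gt0 : (0 < r)%N) (rankMstar : \rank Mstar = r).
Hypotheses (mu_gt0 : 0 < mu) (L_gt0 : 0 < L) (sigma_gt0 : 0 < sigma r Mstar).
Hypothesis step : rsgrad_step f r eta M G M'.

Let k : R := mu ^+ 2 / L ^+ 2.
Let d : R := frob (M - Mstar).

Lemma phase_one_step (E : R) :
  mu * d <= f M - f Mstar -> frob_trunc r G <= L ->
  0 < d <= E -> E <= 1 / 100 * sigma r Mstar * k ->
  2 / 10 * E * (mu / L ^+ 2) <= eta <= 3 / 10 * E * (mu / L ^+ 2) ->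
  k <= 2 /\ frob (M' - Mstar) <= (1 - 4 / 100 * k) * E.
Proof.
move=> sharp GL /andP [d_gt0 dE] Es etaE.
have E_gt0 : 0 < E := lt_le_trans d_gt0 dE.
have mL : 0 < mu / L ^+ 2 by rewrite divr_gt0 // exprn_gt0.
have eta_ge0 : 0 <= eta.
  case/andP: etaE => + _; apply: le_trans.
  by rewrite mulr_ge0 ?(ltW mL) //; lra.
have [ratio] := rsgrad_step_bound r_gt0 rankMstar step eta_ge0
  (ltW (mulr_gt0 mu_gt0 d_gt0)) sharp GL.
move=> [e [e' [N2 [[e0 se] [e'0 se'] /andP [N0 N1] d'N]]]].
have k2 : k <= 2 := ratio_le2 L_gt0 d_gt0 ratio.
have k0 : 0 <= k by rewrite divr_ge0 ?sqr_ge0.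
split=> //; apply: (contraction sigma_gt0 E_gt0 Es _ _ _ _ e'0 se' d'N).
- by rewrite k0.
- by apply/andP; split; lra.
- exact: frob_ge0.
- rewrite N0 /=; apply: le_trans N1 _.
  by apply: phase_one_bound sigma_gt0 _ Es k2 _ _ _ _ => //; rewrite (ltW d_gt0).
Qed.

Lemma phase_two_step :
  mu * d ^+ 2 <= f M - f Mstar -> frob_trunc r G <= L * d ->
  0 < d -> d <= 1 / 100 * sigma r Mstar * k ->
  125 / 1000 * (mu / L ^+ 2) <= eta <= 75 / 100 * (mu / L ^+ 2) ->
  frob (M' - Mstar) <= (1 - 1 / 32 * k) * d.
Proof.
move=> sharp GL d_gt0 ds etaE.
have mL : 0 < mu / L ^+ 2 by rewrite divr_gt0 // exprn_gt0.
have eta_ge0 : 0 <= eta by case/andP: etaE => + _; lra.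
have a_ge0 : 0 <= mu * d ^+ 2 by rewrite mulr_ge0 ?sqr_ge0 // ltW.
have [ratio] := rsgrad_step_bound r_gt0 rankMstar step eta_ge0 a_ge0 sharp GL.
move=> [e [e' [N2 [[e0 se] [e'0 se'] /andP [N0 N1] d'N]]]].
have k2 : k <= 2.
  apply: (ratio_le2 (d := d ^+ 2)) => //; first exact: exprn_gt0.
  by move: ratio; rewrite -/d; lra.
have k0 : 0 <= k by rewrite divr_ge0 ?sqr_ge0.
apply: (contraction sigma_gt0 d_gt0 ds _ _ _ _ e'0 se' d'N).
- by rewrite k0.
- by apply/andP; split; lra.
- exact: frob_ge0.
- rewrite N0 /=; apply: le_trans N1 _.
  exact: phase_two_bound sigma_gt0 _ ds k2 etaE e0 se.
Qed.

End Phases.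

Theorem proposition1 (R : realType) :
  exists c0 : R, 0 < c0 /\
  forall (d1 d2 r n : nat) (Mstar : 'M[R]_(d1, d2))
    (rho : R -> R) (X : 'I_n -> 'M[R]_(d1, d2)) (Y : 'I_n -> R)
    (tau_comp tau_stat mu_comp mu_stat L_comp L_stat : R)
    (K : nat) (M G : nat -> 'M[R]_(d1, d2)) (eta : nat -> R),
  let f := loss rho X Y in
  let dist : nat -> R := fun l => frob (M l - Mstar) in
  let rate := 1 - 4 / 100 * (mu_comp ^+ 2 / L_comp ^+ 2) in
  (0 < r)%N -> \rank Mstar = r ->
  (forall x, 0 <= rho x) ->
  0 < tau_stat -> tau_stat < tau_comp ->
  0 < mu_comp -> 0 < mu_stat -> 0 < L_comp -> 0 < L_stat ->
  dual_phase_regular f r Mstar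
    tau_comp tau_stat mu_comp mu_stat L_comp L_stat ->
  (\rank (M 0%N) <= r)%N ->
  dist 0%N <= c0 * sigma r Mstar *
    Num.min (mu_stat ^+ 2 / L_stat ^+ 2) (mu_comp ^+ 2 / L_comp ^+ 2) ->
  2 / 10 * dist 0%N * (mu_comp / L_comp ^+ 2) <= eta 0%N
    <= 3 / 10 * dist 0%N * (mu_comp / L_comp ^+ 2) ->
  (forall l, (l < K)%N -> rsgrad_step f r (eta l) (M l) (G l) (M l.+1)) ->
  (forall l, (l < K)%N -> tau_comp <= dist l -> eta l = rate ^+ l * eta 0%N) ->
  (forall l, (l < K)%N -> tau_stat <= dist l < tau_comp ->
     125 / 1000 * (mu_stat / L_stat ^+ 2) <= eta l
       <= 75 / 100 * (mu_stat / L_stat ^+ 2)) ->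
  forall l, (l <= K)%N -> (forall k, (k < l)%N -> tau_stat <= dist k) ->
    (tau_comp <= dist l -> dist l <= rate ^+ l * dist 0%N) /\
    ((l < K)%N -> tau_stat <= dist l < tau_comp ->
       dist l.+1 <= (1 - mu_stat ^+ 2 / (32 * L_stat ^+ 2)) * dist l).
Proof.
exists (1 / 100); split; first by lra.
move=> d1 d2 r n Mstar rho X Y tau_comp tau_stat mu_comp mu_stat L_comp L_stat.
move=> K M G eta f dist rate r_gt0 rankMstar _ ts_gt0 tst muc_gt0 mus_gt0 Lc_gt0.
move=> Ls_gt0 reg rankM0 init eta0 steps eta1 eta2 l lK alive.
pose kc := mu_comp ^+ 2 / L_comp ^+ 2; pose ks := mu_stat ^+ 2 / L_stat ^+ 2.
have kc_gt0 : 0 < kc by rewrite divr_gt0 // exprn_gt0.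
have ks_gt0 : 0 < ks by rewrite divr_gt0 // exprn_gt0.
(* In every case of interest the initial distance is at least [tau_stat > 0], and
   so [sigma r Mstar] is positive. *)
suff main : tau_stat <= dist 0%N ->
    (tau_comp <= dist l -> dist l <= rate ^+ l * dist 0%N) /\
    ((l < K)%N -> tau_stat <= dist l < tau_comp ->
       dist l.+1 <= (1 - mu_stat ^+ 2 / (32 * L_stat ^+ 2)) * dist l).
  split=> [tc|lK' tsc].
    apply: (proj1 (main _) tc); case: (posnP l) => [l0|/alive //].
    by move: tc; rewrite l0; exact/le_trans/ltW.
  apply: (proj2 (main _) lK' tsc); case: (posnP l) => [l0|/alive //].
  by move: tsc; rewrite l0 => /andP [].
move=> ts0; have dist0_gt0 : 0 < dist 0%N := lt_le_trans ts_gt0 ts0.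
have min_gt0 : 0 < Num.min ks kc by rewrite lt_min ks_gt0.
have sigma_gt0 : 0 < sigma r Mstar.
  have := lt_le_trans dist0_gt0 init; rewrite pmulr_lgt0 //; lra.
have init_s : dist 0%N <= 1 / 100 * sigma r Mstar * ks.
  apply: le_trans init _; rewrite ler_wpM2l ?ge_min ?lexx //.
  by move: sigma_gt0; lra.
have init_c : dist 0%N <= 1 / 100 * sigma r Mstar * kc.
  apply: le_trans init _; rewrite ler_wpM2l ?ge_min ?lexx ?orbT //.
  by move: sigma_gt0; lra.
have one i (E : R) : (i < K)%N -> tau_comp <= dist i -> dist i <= E ->
    E <= dist 0%N ->
    2 / 10 * E * (mu_comp / L_comp ^+ 2) <= eta i
      <= 3 / 10 * E * (mu_comp / L_comp ^+ 2) ->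
    kc <= 2 /\ dist i.+1 <= rate * E.
  move=> iK tc dE E0 etaE; have Si := steps _ iK.
  have reg1 : region1 r Mstar tau_comp (M i).
    by split=> //; exact: rsgrad_step_low_rank Si.
  have di_gt0 : 0 < dist i by apply: lt_le_trans tc; exact: lt_trans tst.
  apply: (phase_one_step r_gt0 rankMstar muc_gt0 Lc_gt0 sigma_gt0 Si) etaE.
  - exact: (sharp_comp reg).
  - by apply: (subgrad_comp reg reg1); case: Si.
  - by rewrite di_gt0.
  - exact: le_trans init_c.
have two i : (i < K)%N -> tau_stat <= dist i < tau_comp -> dist i <= dist 0%N ->
    dist i.+1 <= (1 - 1 / 32 * ks) * dist i.
  move=> iK tsc di0; have Si := steps _ iK.
  have reg2 : region2 r Mstar tau_comp tau_stat (M i).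
    by split=> //; exact: rsgrad_step_low_rank Si.
  have di_gt0 : 0 < dist i by case/andP: tsc => + _; exact: lt_le_trans.
  apply: (phase_two_step r_gt0 rankMstar mus_gt0 Ls_gt0 sigma_gt0 Si _ _ _ _ _) => //.
  - exact: (sharp_stat reg).
  - by apply: (subgrad_stat reg reg2); case: Si.
  - exact: le_trans init_s.
  - exact: eta2.
(* No iterate is farther than the first one, and those in phase one satisfy the
   geometric bound [E i]; an iterate below [tau_comp] never climbs back. *)
pose E i := rate ^+ i * dist 0%N.
have inv i : (i <= l)%N -> dist i <= dist 0%N /\
    (tau_comp <= dist i -> dist i <= E i /\ E i <= dist 0%N).
  elim: i => [_|i IHi il]; first by rewrite /E expr0 mul1r lexx.
  have [di0 phase1] := IHi (ltnW il); have iK := leq_trans il lK.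
  have [tc|tc] := leP tau_comp (dist i).
    have [dE E0] := phase1 tc.
    have E_gt0 : 0 < E i.
      by apply: lt_le_trans dE; apply: lt_le_trans tc; exact: lt_trans tst.
    have rate_gt0 : 0 < rate ^+ i by move: E_gt0; rewrite /E pmulr_lgt0.
    have [|kc2 d'] := one i (E i) iK tc dE E0.
      rewrite (eta1 _ iK tc) /E; case/andP: eta0 => eta01 eta02.
      have := ler_wpM2l (ltW rate_gt0) eta01.
      have := ler_wpM2l (ltW rate_gt0) eta02.
      by move=> h1 h2; apply/andP; split; lra.
    have rate01 : 0 <= rate <= 1 by rewrite /rate -/kc; apply/andP; split; lra.
    have EE : E i.+1 = rate * E i by rewrite /E exprS mulrA.
    have E'E : E i.+1 <= E i.
      by rewrite EE ler_piMl ?(ltW E_gt0) //; case/andP: rate01.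
    rewrite -EE in d'.
    by split=> [|_]; [|split=> //]; rewrite ?(le_trans d') // (le_trans E'E).
  have d' := two i iK _ di0; rewrite alive // tc in d'; have {}d' := d' isT.
  have d'd : dist i.+1 <= dist i.
    apply: le_trans d' _; rewrite ler_piMl ?frob_ge0 //; lra.
  split=> [|tc']; first exact: le_trans di0.
  by have := lt_le_trans tc (le_trans tc' d'd); rewrite ltxx.
have [dl0 phase1] := inv l (leqnn l).
split=> [/phase1 [] //|lK' tsc].
have := two l lK' tsc dl0; rewrite (_ : 1 / 32 * ks = mu_stat ^+ 2 / (32 * L_stat ^+ 2)) //.
by rewrite /ks; field; rewrite gt_eqF.
Qed.
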